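(* Every nontrivial quadratic Novikov algebra of dimension $3$ over $\mathbb{C}$ is (up to isomorphism of quadratic Novikov algebras) obtained as a double extension of a $1$-dimensional trivial quadratic Novikov algebra by a $1$-dimensional Novikov algebra with a symmetric bilinear form.
   Context: All vector spaces are over $\mathbb{C}$. A Novikov algebra $(A,\circ)$ is a vector space with a bilinear operation $\circ$ such that $(a\circ b)\circ c-a\circ(b\circ c)=(b\circ a)\circ c-b\circ(a\circ c)$ and $(a\circ b)\circ c=(a\circ c)\circ b$ for all $a,b,c\in A$. It is trivial if $a\circ b=0$ for all $a,b$, and nontrivial otherwise. Put $a\star b:=a\circ b+b\circ a$. A quadratic Novikov algebra $(A,\circ,B(\cdot,\cdot))$ is a Novikov algebra with a nondegenerate symmetric bilinear form $B:A\times A\to\mathbb{C}$ such that $B(a\circ b,c)=-B(b,a\star c)$ for all $a,b,c\in A$; it is trivial (nontrivial) if $(A,\circ)$ is. An isomorphism of quadratic Novikov algebras is a linear bijection preserving the products and the bilinear forms. Double extension: let $(A_1,\circ,B_1(\cdot,\cdot))$ be a quadratic Novikov algebra and $(A_2,\circ)$ a Novikov algebra with a symmetric bilinear form $\tau(\cdot,\cdot)$ (not assumed invariant or nondegenerate). Given linear maps $\mu,\mu':A_2\to\mathrm{End}(A_1)$ and bilinear maps $\varphi:A_1\times A_1\to A_2^\ast$, $v:A_2\times A_1\to A_2^\ast$, $v':A_1\times A_2\to A_2^\ast$, $\lambda:A_2\times A_2\to A_1$, $\gamma:A_2\times A_2\to A_2^\ast$, define on $A_2\oplus A_1\oplus A_2^\ast$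 $$\begin{aligned}(x_2+x_1+f)\cdot(y_2+y_1+g)=\;&x_2\circ y_2+\lambda(x_2,y_2)+\gamma(x_2,y_2)+x_1\circ y_1+\varphi(x_1,y_1)+\mu(x_2)(y_1)\\&+v(x_2,y_1)+L_\star^\ast(x_2)g+\mu'(y_2)(x_1)+v'(x_1,y_2)-R_\circ^\ast(y_2)f,\\ B(x_2+x_1+f,\,y_2+y_1+g)=\;&\tau(x_2,y_2)+B_1(x_1,y_1)+f(y_2)+g(x_2),\end{aligned}$$ where $(L_\star^\ast(x)f)(z)=-f(x\circ z+z\circ x)$ and $(R_\circ^\ast(y)f)(z)=-f(z\circ y)$ for $x,y,z\in A_2$, $f\in A_2^\ast$. Whenever $(A_2\oplus A_1\oplus A_2^\ast,\cdot,B(\cdot,\cdot))$ is a quadratic Novikov algebra, it is called a double extension of $(A_1,\circ,B_1(\cdot,\cdot))$ by the Novikov algebra $(A_2,\circ)$ with the symmetric bilinear form $\tau(\cdot,\cdot)$. *)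

(* Defs.v *)
From HB Require Import structures.
From mathcomp Require Import all_boot all_order all_algebra.
From mathcomp Require Import sesquilinear complex reals.

Set Implicit Arguments.
Unset Strict Implicit.
Unset Printing Implicit Defensive.

Import GRing.Theory.
Local Open Scope ring_scope.

(* The complex numbers are the case K = R[i] with R : realType. *)
Record novikov (K : fieldType) (A : lmodType K) := Novikov {
  nov_mul : {bilinear A -> A -> A};
  nov_lsym : forall a b c : A,
    nov_mul (nov_mul a b) c - nov_mul a (nov_mul b c)
    = nov_mul (nov_mul b a) c - nov_mul b (nov_mul a c);
  nov_rcom : forall a b c : A,
    nov_mul (nov_mul a b) c = nov_mul (nov_mul a c) b }.

Definition nov_trivial (K : fieldType) (A : lmodType K) (N : novikov A) : Prop :=
  forall a b : A, nov_mul N a b = 0.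

Definition nov_star (K : fieldType) (A : lmodType K) (N : novikov A) (a b : A) : A :=
  nov_mul N a b + nov_mul N b a.

Record quad_novikov (K : fieldType) (A : vectType K) := QuadNovikov {
  qn_nov :> novikov A;
  qn_form : {symmetric A};
  qn_nondeg : nondegenerate qn_form;
  qn_inv : forall a b c : A,
    qn_form (nov_mul qn_nov a b) c = - qn_form b (nov_star qn_nov a c) }.

Definition qn_isomorphic (K : fieldType) (A A' : vectType K)
    (Q : quad_novikov A) (Q' : quad_novikov A') : Prop :=
  exists theta : {linear A -> A'},
    [/\ bijective theta,
        forall a b, theta (nov_mul Q a b) = nov_mul Q' (theta a) (theta b)
      & forall a b, qn_form Q' (theta a) (theta b) = qn_form Q a b].

Definition dual (K : fieldType) (A : vectType K) : vectType K := 'Hom(A, K^o).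

Section CoadjointMaps.
Variables (K : fieldType) (A : vectType K) (N : novikov A).

(* linfun f is the element of 'Hom with underlying function f provided that f
   is linear; the lemmas LstarE and RdualE below show that this is the case. *)
Definition Lstar (x : A) (f : dual A) : dual A :=
  linfun (fun z : A => - f (nov_star N x z) : K^o).

Definition Rdual (y : A) (f : dual A) : dual A :=
  linfun (fun z : A => - f (nov_mul N z y) : K^o).

Lemma LstarE x (f : dual A) z :
  Lstar x f z = - f (nov_mul N x z + nov_mul N z x).
Proof.
have lin : linear (fun z : A => - f (nov_star N x z) : K^o).
  move=> a u w; rewrite /nov_star linearPr linearPl addrACA -scalerDr linearP.
  by rewrite opprD scalerN.
pose h := GRing.isLinear.Build _ _ _ _ _ lin.
pose g : {linear A -> K^o} := HB.pack (fun z : A => - f (nov_star N x z) : K^o) h.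
exact: (lfunE g z).
Qed.

Lemma RdualE y (f : dual A) z : Rdual y f z = - f (nov_mul N z y).
Proof.
have lin : linear (fun z : A => - f (nov_mul N z y) : K^o).
  by move=> a u w; rewrite linearPl linearP opprD scalerN.
pose h := GRing.isLinear.Build _ _ _ _ _ lin.
pose g : {linear A -> K^o} := HB.pack (fun z : A => - f (nov_mul N z y) : K^o) h.
exact: (lfunE g z).
Qed.

End CoadjointMaps.

Section DoubleExtension.
Variables (K : fieldType) (A1 A2 : vectType K).

Record dext_data := DextData {
  dx_mu : {linear A2 -> 'End(A1)};
  dx_mu' : {linear A2 -> 'End(A1)};
  dx_phi : {bilinear A1 -> A1 -> dual A2};
  dx_v : {bilinear A2 -> A1 -> dual A2};
  dx_v' : {bilinear A1 -> A2 -> dual A2};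
  dx_lambda : {bilinear A2 -> A2 -> A1};
  dx_gamma : {bilinear A2 -> A2 -> dual A2} }.

(* (x2, x1, f) stands for x2 + x1 + f. *)
Definition dext_space : vectType K := (A2 * A1 * dual A2)%type.

Variables (Q1 : quad_novikov A1) (N2 : novikov A2) (tau : {symmetric A2}).

Definition dext_mul (d : dext_data) (x y : dext_space) : dext_space :=
  let: (x2, x1, f) := x in
  let: (y2, y1, g) := y in
  (nov_mul N2 x2 y2,
   dx_lambda d x2 y2 + nov_mul Q1 x1 y1 + dx_mu d x2 y1 + dx_mu' d y2 x1,
   dx_gamma d x2 y2 + dx_phi d x1 y1 + dx_v d x2 y1 + Lstar N2 x2 g
   + dx_v' d x1 y2 - Rdual N2 y2 f).

Definition dext_form (x y : dext_space) : K :=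
  let: (x2, x1, f) := x in
  let: (y2, y1, g) := y in
  tau x2 y2 + qn_form Q1 x1 y1 + f y2 + g x2.

Definition is_double_extension (D : quad_novikov dext_space) : Prop :=
  exists d : dext_data,
    (forall x y, nov_mul D x y = dext_mul d x y) /\
    (forall x y, qn_form D x y = dext_form x y).

End DoubleExtension.

(* Main.v *)
Require Import Defs.
From HB Require Import structures.
From mathcomp Require Import all_boot all_order all_algebra.
From mathcomp Require Import sesquilinear complex reals spectral.
From mathcomp Require Import ring.

(* The trilinear form T(a,b,c) = B(a o b, c) satisfies T(a,b,c) = T(c,b,a), and
   its cyclic sums vanish. The right multiplications commute, so over C they
   have a common eigenvector e. If e is isotropic, e^perp is spanned by e and a
   unit vector a, and comparing (a o a) o e with (a o e) o a gives e o a = 0. If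
   e is not isotropic, it annihilates the algebra; on the hyperbolic plane
   e^perp = <x, f>, commutation of the right multiplications by x and f gives
   T(x,x,f) T(f,f,x) = 0, so f or x is an isotropic common eigenvector. In both
   cases one gets an isotropic f with f o f = f o a = 0 and f o x in <f>, where
   B(x,f) = B(a,a) = 1 and the other products of x, a, f under B vanish. The
   decomposition <x> + <a> + <f> then exhibits a double extension of <a> by <x>,
   with <f> in the role of the dual of <x>. *)

Set Implicit Arguments.
Unset Strict Implicit.
Unset Printing Implicit Defensive.

Import GRing.Theory Num.Theory.
Local Open Scope ring_scope.

(** * Transport of a quadratic Novikov structure along a linear bijection *)

Section Transport.
Variables (K : fieldType) (A E : vectType K) (Q : quad_novikov A).
Variables (theta : {linear A -> E}) (psi : {linear E -> A}).
Hypotheses (thetaK : cancel theta psi) (psiK : cancel psi theta).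

Definition transport_mul (u v : E) : E := theta (nov_mul Q (psi u) (psi v)).
Definition transport_form (u v : E) : K := qn_form Q (psi u) (psi v).

Lemma transport_mul_bilinear : bilinear_for
  (GRing.Scale.Law.clone _ _ *:%R _) (GRing.Scale.Law.clone _ _ *:%R _)
  transport_mul.
Proof.
split=> [u'|u] a x y; rewrite /transport_mul /= linearP.
  by rewrite linearPl linearP.
by rewrite linearPr linearP.
Qed.

HB.instance Definition _ := bilinear_isBilinear.Build K E E E _ _
  transport_mul transport_mul_bilinear.

Lemma transport_form_bilinear : bilinear_for
  (GRing.Scale.Law.clone _ _ *%R _) (GRing.Scale.Law.clone _ _ (idfun \; *%R) _)
  transport_form.
Proof.
split=> [u'|u] a x y; rewrite /transport_form /= linearP.
  by rewrite linearPl.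
by rewrite linearPr.
Qed.

HB.instance Definition _ := bilinear_isBilinear.Build K E E K _ _
  transport_form transport_form_bilinear.

Lemma transport_form_sym u v :
  transport_form u v = (-1) ^+ false * idfun (transport_form v u).
Proof. by rewrite /transport_form hermC. Qed.

HB.instance Definition _ := isHermitianSesquilinear.Build K E false idfun
  transport_form transport_form_sym.

Lemma transport_novikov_lsym u v w :
  transport_mul (transport_mul u v) w - transport_mul u (transport_mul v w)
  = transport_mul (transport_mul v u) w - transport_mul v (transport_mul u w).
Proof. by rewrite /transport_mul !thetaK -!linearB /= nov_lsym. Qed.

Lemma transport_novikov_rcom u v w :
  transport_mul (transport_mul u v) w = transport_mul (transport_mul u w) v.
Proof. by rewrite /transport_mul !thetaK nov_rcom. Qed.

Definition transport_novikov : novikov E :=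
  @Novikov K E transport_mul transport_novikov_lsym transport_novikov_rcom.

Lemma transport_form_nondeg : nondegenerate transport_form.
Proof.
rewrite /nondegenerate -subv0; apply/subvP => u /mem_orthovP u_orth.
have: psi u \in orthov (qn_form Q) fullv.
  apply/mem_orthovP => v _.
  by have := u_orth (theta v) (memvf _); rewrite /= /transport_form thetaK.
rewrite (eqP (qn_nondeg Q)) !memv0 => /eqP psiu0.
by rewrite -[u]psiK psiu0 linear0.
Qed.

Lemma transport_form_inv u v w :
  transport_form (transport_mul u v) w
  = - transport_form v (nov_star transport_novikov u w).
Proof.
rewrite /nov_star /= /transport_form /transport_mul -linearD !thetaK.
exact: qn_inv.
Qed.

Definition transport : quad_novikov E :=
  @QuadNovikov K E transport_novikov transport_form
    transport_form_nondeg transport_form_inv.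

Lemma transport_isomorphic : qn_isomorphic Q transport.
Proof.
exists theta; split; first by exists psi.
  by move=> a b; rewrite /= /transport_mul !thetaK.
by move=> a b; rewrite /= /transport_form !thetaK.
Qed.

End Transport.

(** * Symmetries of the trilinear form T(u,v,w) = B(u o v, w) *)

Section QuadraticNovikov.
Variables (K : fieldType) (A : vectType K) (Q : quad_novikov A).
Implicit Types u v w : A.

Local Notation "u ** v" := (nov_mul Q u v) (at level 40).
Local Notation "''[' u , v ]" := (qn_form Q u v).

Lemma qn_formC u v : '[u, v] = '[v, u].
Proof. by rewrite hermC mul1r. Qed.

(* That is, right multiplications are self-adjoint. *)
Lemma qn_form_swap u v w : '[u ** v, w] = '[w ** v, u].
Proof.
(* Invariance expands T(v,u,w) and T(v,w,u), each through the other; in the difference only T(u,v,w)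
   - T(w,v,u) survives. *)
have E1 := qn_inv Q v u w; have E2 := qn_inv Q v w u.
rewrite /nov_star !linearDr /= ![qn_form Q _ (nov_mul Q _ _)]qn_formC in E1 E2.
apply/eqP; rewrite -subr_eq0.
have -> : '[u ** v, w] - '[w ** v, u]
    = ('[v ** w, u] - - ('[v ** u, w] + '[u ** v, w]))
      - ('[v ** u, w] - - ('[v ** w, u] + '[w ** v, u])) by ring.
by rewrite -E1 -E2 !subrr.
Qed.

(** Invariance gives T(u,v,w) = -T(u,w,v) - T(w,u,v), and the swap turns T(u,w,v) into T(v,w,u). *)
Lemma qn_form_cyclic u v w : '[u ** v, w] + '[v ** w, u] + '[w ** u, v] = 0.
Proof.
rewrite qn_inv /nov_star linearDr /= ![qn_form Q _ (nov_mul Q _ _)]qn_formC.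
rewrite (qn_form_swap u w v); ring.
Qed.

Lemma qn_form_cube u : (3 : K) != 0 -> '[u ** u, u] = 0.
Proof.
move=> nz3; have := qn_form_cyclic u u u => /eqP.
have -> : '[u ** u, u] + '[u ** u, u] + '[u ** u, u] = 3 * '[u ** u, u] by ring.
by rewrite mulf_eq0 (negPf nz3) => /eqP.
Qed.

Lemma qn_form_inj u v : (forall w, '[u, w] = '[v, w]) -> u = v.
Proof.
move=> uv; apply/eqP; rewrite -subr_eq0 -memv0 -(eqP (qn_nondeg Q)).
by apply/mem_orthovP => w _; rewrite linearBl /= uv subrr.
Qed.

End QuadraticNovikov.

(** * Bases made of a hyperbolic pair and an orthogonal unit vector *)

Section HyperbolicTriples.
Variables (K : fieldType) (A : vectType K) (Q : quad_novikov A).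
Hypothesis dimA : \dim {:A} = 3%N.
Implicit Types u v w : A.

Local Notation "u ** v" := (nov_mul Q u v) (at level 40).
Local Notation "''[' u , v ]" := (qn_form Q u v).
Local Notation "u ^!" := (orthov (qn_form Q) <[u]>%VS).

Definition hyperbolic_triple x a f :=
  [/\ '[x, x] = 0, '[f, f] = 0 & '[x, f] = 1] /\
  [/\ '[a, x] = 0, '[a, f] = 0 & '[a, a] = 1].

Lemma hyperbolic_triple_sym x a f :
  hyperbolic_triple x a f -> hyperbolic_triple f a x.
Proof. by case=> [[xx ff xf] [ax af aa]]; split; split=> //; rewrite qn_formC. Qed.

(** Each orthogonality condition lowers the dimension by exactly one: [x] witnesses that the
    condition against [f] is not void, and [f], being isotropic, lies in its own perp and does the
    same for [x]. *)
Lemma hyperbolic_perp_dim x f : '[x, x] = 0 -> '[f, f] = 0 -> '[x, f] = 1 ->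
  \dim (f^! :&: x^!) = 1%N.
Proof.
move=> xx ff xf.
have f_dim : \dim f^! = 2%N.
  have /eq_dim_orthov1 : f \notin orthov (qn_form Q) fullv.
    apply/mem_orthovPn; exists x; first exact: memvf.
    by rewrite qn_formC xf oner_eq0.
  by rewrite dimA capfv.
have /eq_dim_orthov1 : x \notin orthov (qn_form Q) f^!.
  apply/mem_orthovPn; exists f; first by rewrite mem_orthov1 ff.
  by rewrite xf oner_eq0.
by rewrite f_dim.
Qed.

Lemma mem_perp2 u v w : (w \in (u^! :&: v^!)%VS) = ('[w, u] == 0) && ('[w, v] == 0).
Proof. by rewrite memv_cap !mem_orthov1. Qed.

(** The two sides differ by a vector orthogonal to [f], [x] and [a]. A third cut, by [a], reduces
    the line orthogonal to [f] and [x] to zero. *)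
Lemma hyperbolic_decomp x a f w : hyperbolic_triple x a f ->
  w = '[w, f] *: x + '[w, a] *: a + '[w, x] *: f.
Proof.
move=> [[xx ff xf] [ax af aa]].
have fx : '[f, x] = 1 by rewrite qn_formC.
have xa : '[x, a] = 0 by rewrite qn_formC.
have fa : '[f, a] = 0 by rewrite qn_formC.
set w' := RHS; apply/eqP; rewrite -subr_eq0 -memv0.
suff <- : (f^! :&: x^! :&: a^!)%VS = 0%VS.
  rewrite memv_cap mem_perp2 !mem_orthov1 !linearBl !linearDl !linearZl_LR /=.
  rewrite xx ff xf ax af aa fx xa fa.
  by rewrite !(mulr0, mulr1, addr0, add0r) !subrr eqxx.
apply/eqP; rewrite -dimv_eq0.
have /eq_dim_orthov1 <- : a \notin orthov (qn_form Q) (f^! :&: x^!)%VS.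
  apply/mem_orthovPn; exists a; first by rewrite mem_perp2 ax af eqxx.
  by rewrite aa oner_eq0.
by rewrite hyperbolic_perp_dim.
Qed.

Lemma isotropic_partner f : (2 : K) != 0 -> f != 0 -> '[f, f] = 0 ->
  exists x, '[x, x] = 0 /\ '[x, f] = 1.
Proof.
move=> nz2 f_neq0 ff.
have [y fy] : exists y, '[f, y] != 0.
  have : f \notin orthov (qn_form Q) fullv by rewrite (eqP (qn_nondeg Q)) memv0.
  by case/mem_orthovPn => y _; exists y.
have [z fz] : exists z, '[f, z] = 1.
  by exists ('[f, y]^-1 *: y); rewrite linearZr_LR /= mulVf.
have zf : '[z, f] = 1 by rewrite qn_formC.
(* Subtracting t [f] lowers the norm of [z] by 2t and keeps its pairing with the isotropic [f]. *)
exists (z - ('[z, z] / 2) *: f).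
rewrite !linearBl !linearBr !linearZl_LR !linearZr_LR /= ff zf fz.
by split; [field|ring].
Qed.

Lemma hyperbolic_extend_anisotropic a f : (2 : K) != 0 ->
  f != 0 -> '[f, f] = 0 -> '[a, f] = 0 -> '[a, a] = 1 ->
  exists x, hyperbolic_triple x a f.
Proof.
move=> nz2 f_neq0 ff af aa.
have fa : '[f, a] = 0 by rewrite qn_formC.
have [y [yy yf]] := isotropic_partner nz2 f_neq0 ff.
have fy : '[f, y] = 1 by rewrite qn_formC.
(* Removing the component along [a] leaves norm -B(y,a)^2; the multiple of [f] restores norm 0. *)
exists (y - '[y, a] *: a + ('[y, a] ^+ 2 / 2) *: f).
have ay : '[a, y] = '[y, a] by rewrite qn_formC.
split; split=> //.
- rewrite !linearDl !linearNl !linearDr !linearNr /= !linearZl_LR !linearZr_LR /=.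
  by rewrite yy yf fy ff aa af fa ay; field.
- by rewrite !linearDl linearNl /= !linearZl_LR /= yf ff af !mulr0 subr0 addr0.
- rewrite !linearDr linearNr /= !linearZr_LR /= aa af ay.
  by rewrite mulr1 mulr0 subrr addr0.
Qed.

End HyperbolicTriples.

(** * Linear and bilinear maps on a line, given by their value at 1 *)

Section RankOneMaps.
Variables (K : fieldType) (V : lmodType K) (w : V).

Definition rank1_lin (s : K^o) : V := (s : K) *: w.
Definition rank1_bilin (s t : K^o) : V := (s * t : K) *: w.

Lemma rank1_lin_linear : linear rank1_lin.
Proof. by move=> a s t; rewrite /rank1_lin scalerDl scalerA. Qed.

HB.instance Definition _ :=
  GRing.isLinear.Build K K^o V _ rank1_lin rank1_lin_linear.

Lemma rank1_bilin_bilinear : bilinear_for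
  (GRing.Scale.Law.clone _ _ *:%R _) (GRing.Scale.Law.clone _ _ *:%R _)
  rank1_bilin.
Proof.
split=> [u'|u] a s t; rewrite /rank1_bilin /= scalerA -scalerDl; congr (_ *: _).
  by rewrite mulrDl -mulrA.
by rewrite mulrDr mulrCA.
Qed.

HB.instance Definition _ := bilinear_isBilinear.Build K K^o K^o V _ _
  rank1_bilin rank1_bilin_bilinear.

End RankOneMaps.

(** * Novikov products and symmetric forms on the line *)

Section LineAlgebras.
Variables (K : fieldType) (c : K).

Definition line_form (s t : K^o) : K := c * (s * t).

Lemma line_form_bilinear : bilinear_for
  (GRing.Scale.Law.clone _ _ *%R _) (GRing.Scale.Law.clone _ _ (idfun \; *%R) _)
  line_form.
Proof. by split=> [u'|u] a s t; rewrite /line_form /= /GRing.scale /=; ring. Qed.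

HB.instance Definition _ := bilinear_isBilinear.Build K K^o K^o K _ _
  line_form line_form_bilinear.

Lemma line_form_sym s t :
  line_form s t = (-1) ^+ false * idfun (line_form t s).
Proof. by rewrite /line_form /=; ring. Qed.

HB.instance Definition _ := isHermitianSesquilinear.Build K K^o false idfun
  line_form line_form_sym.

Definition line_mul : {bilinear K^o -> K^o -> K^o} := rank1_bilin (c : K^o).

Lemma line_mulE s t : line_mul s t = s * t * c :> K. Proof. by []. Qed.

Lemma line_mul_lsym s t u :
  line_mul (line_mul s t) u - line_mul s (line_mul t u)
  = line_mul (line_mul t s) u - line_mul t (line_mul s u).
Proof. by rewrite !line_mulE; ring. Qed.

Lemma line_mul_rcom s t u :
  line_mul (line_mul s t) u = line_mul (line_mul s u) t.
Proof. by rewrite !line_mulE; ring. Qed.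

Definition line_novikov : novikov K^o := Novikov line_mul_lsym line_mul_rcom.

End LineAlgebras.

(** * The one-dimensional trivial quadratic Novikov algebra *)

Section TrivialLine.
Variable K : fieldType.

Lemma line_form_nondeg : nondegenerate (line_form (1 : K)).
Proof.
rewrite /nondegenerate -subv0; apply/subvP => s /mem_orthovP s_orth.
have := s_orth 1 (memvf _); rewrite /= /line_form mul1r mulr1 => ->.
exact: mem0v.
Qed.

Lemma line_form_inv (s t u : K^o) :
  line_form 1 (line_mul 0 s t) u = - line_form 1 t (nov_star (line_novikov 0) s u).
Proof. by rewrite /nov_star /line_form /= !line_mulE; ring. Qed.

Definition trivial_line : quad_novikov K^o :=
  @QuadNovikov K K^o (line_novikov 0) (line_form 1)
    line_form_nondeg line_form_inv.

Lemma trivial_line_trivial : nov_trivial trivial_line.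
Proof. by move=> s t; rewrite /= line_mulE mulr0. Qed.

Lemma dim_line : \dim {:(K^o : vectType K)} = 1%N.
Proof. by rewrite dimvf. Qed.

Lemma dual_lineE (h : dual K^o) (s : K^o) : h s = s * h 1 :> K.
Proof. by rewrite -{1}[s]mulr1; exact: (linearZ_LR h s 1). Qed.

End TrivialLine.

(** * From an adapted triple to a double extension *)

Section AdaptedTriple.
Variables (K : fieldType) (A : vectType K) (Q : quad_novikov A).
Hypotheses (dimA : \dim {:A} = 3%N) (nz3 : (3 : K) != 0).
Variables (x a f : A) (c : K).
Hypothesis xaf : hyperbolic_triple Q x a f.

Local Notation "u ** v" := (nov_mul Q u v) (at level 40).
Local Notation "''[' u , v ]" := (qn_form Q u v).
Local Notation E := (dext_space (K^o : vectType K) (K^o : vectType K)).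

(** Coordinates along [x], [a], [f] are the pairings with [f], [a], [x]. The identity functional
    generates the dual of the line and is the image of [f]. *)
Definition triple_to (z : A) : E :=
  (('[z, f] : K^o), ('[z, a] : K^o), '[z, x] *: (\1%VF : dual K^o)).

Definition triple_from (u : E) : A :=
  (u.1.1 : K) *: x + (u.1.2 : K) *: a + (u.2 1 : K) *: f.

Lemma triple_to_linear : linear triple_to.
Proof.
move=> k u v; rewrite /triple_to; congr (_, _, _).
- by rewrite linearPl.
- by rewrite linearPl.
by rewrite linearPl scalerDl -scalerA.
Qed.

HB.instance Definition _ :=
  GRing.isLinear.Build K A E _ triple_to triple_to_linear.

Lemma triple_from_linear : linear triple_from.
Proof.
move=> k u v; rewrite /triple_from add_lfunE scale_lfunE /= !scalerDr.
rewrite !scalerDl -!scalerA [RHS]addrACA; congr (_ + _).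
by rewrite [RHS]addrACA.
Qed.

HB.instance Definition _ :=
  GRing.isLinear.Build K E A _ triple_from triple_from_linear.

Lemma triple_toK : cancel triple_to triple_from.
Proof.
move=> z; rewrite [RHS](hyperbolic_decomp dimA z xaf) /triple_from /=.
by rewrite scale_lfunE id_lfunE /GRing.scale /= mulr1.
Qed.

Lemma triple_form (u v : E) : '[triple_from u, triple_from v]
  = (u.1.1 : K) * v.2 1 + (u.1.2 : K) * v.1.2 + u.2 1 * (v.1.1 : K).
Proof.
have [[xx ff xf] [ax af aa]] := xaf.
rewrite /triple_from !linearDl /= !linearDr /= !linearZl_LR !linearZr_LR /=.
rewrite xx ff xf ax af aa (qn_formC Q x a) (qn_formC Q f a) (qn_formC Q f x).
by rewrite ax af xf; ring.
Qed.

(** Leaving [w] free lets [w] = [f], [a], [x] yield the three coordinates of a product from the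
    values of T on the triple. *)
Lemma triple_product_form (u v : E) (w : A) :
  '[triple_from u ** triple_from v, w]
  = (u.1.1 : K) * ((v.1.1 : K) * '[x ** x, w] + (v.1.2 : K) * '[x ** a, w]
                   + v.2 1 * '[x ** f, w])
    + (u.1.2 : K) * ((v.1.1 : K) * '[a ** x, w] + (v.1.2 : K) * '[a ** a, w]
                   + v.2 1 * '[a ** f, w])
    + u.2 1 * ((v.1.1 : K) * '[f ** x, w] + (v.1.2 : K) * '[f ** a, w]
                   + v.2 1 * '[f ** f, w]).
Proof.
have expand (y : A) : y ** triple_from v
    = (v.1.1 : K) *: (y ** x) + (v.1.2 : K) *: (y ** a) + v.2 1 *: (y ** f).
  by rewrite /triple_from !linearDr /= !linearZr_LR.
rewrite {1}/triple_from !linearDl /= !linearZl_LR /= ?linearDl /= ?linearZl_LR /=.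
by rewrite !expand !linearDl /= !linearZl_LR /=.
Qed.

Hypotheses (ff0 : f ** f = 0) (fa0 : f ** a = 0) (fx : f ** x = c *: f).

Lemma triple_fromK : cancel triple_from triple_to.
Proof.
have [[xx ff xf] [ax af aa]] := xaf.
move=> [[s t] h]; rewrite /triple_to /triple_from /= !linearDl /= !linearZl_LR /=.
rewrite xx ff xf ax af aa (qn_formC Q x a) (qn_formC Q f a) (qn_formC Q f x).
rewrite ax af xf !mulr0 !mulr1 !addr0 !add0r. congr (_, _).
by apply/lfunP => z; rewrite scale_lfunE id_lfunE (dual_lineE h z) mulrC.
Qed.

(** Each structure map is a coordinate of a product of [x] and [a]: pairing with [a] gives the A1
    part, pairing with [x] the dual part. *)
Definition triple_data : dext_data (K^o : vectType K) (K^o : vectType K) :=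
  @DextData K K^o K^o
    (rank1_lin ('[x ** a, a] *: \1%VF : 'End(K^o : vectType K)))
    (rank1_lin ('[a ** x, a] *: \1%VF : 'End(K^o : vectType K)))
    (rank1_bilin ('[a ** a, x] *: \1%VF : dual K^o))
    (rank1_bilin ('[x ** a, x] *: \1%VF : dual K^o))
    (rank1_bilin ('[a ** x, x] *: \1%VF : dual K^o))
    (rank1_bilin ('[x ** x, a] : K^o))
    (rank1_bilin ('[x ** x, x] *: \1%VF : dual K^o)).

Definition triple_dext : quad_novikov E := transport Q triple_toK triple_fromK.

(** Coordinates are compared one by one. The A2 product constant is T(x,x,f) = T(f,x,x) = [c], and
    [tau] vanishes because [x] is isotropic. *)
Lemma triple_double_extension :
  is_double_extension (trivial_line K) (line_novikov c) (line_form 0) triple_dext.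
Proof.
have [[xx ff xf] [ax af aa]] := xaf.
have xa : '[x, a] = 0 by rewrite qn_formC.
have fa : '[f, a] = 0 by rewrite qn_formC.
have f_x : '[f, x] = 1 by rewrite qn_formC.
have T_fx w : '[f ** x, w] = c * '[f, w] by rewrite fx linearZl_LR.
have T_ff w : '[f ** f, w] = 0 by rewrite ff0 linear0l.
have T_fa w : '[f ** a, w] = 0 by rewrite fa0 linear0l.
have T_f u v : '[u ** v, f] = '[f ** v, u] by rewrite qn_form_swap.
have T_xfx : '[x ** f, x] = - (2 * c).
  have := qn_form_cyclic Q x f x; rewrite T_fx f_x T_f T_fx f_x => /eqP.
  by rewrite -addrA addr_eq0 => /eqP ->; ring.
(* The coordinates of [a ** f] must vanish, since the extension product has no term combining x_1
   with g. *)
have T_afa : '[a ** f, a] = 0.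
  have := qn_form_cyclic Q a f a; rewrite T_fa T_f T_fa => /eqP.
  by rewrite !addr0 => /eqP.
have T_afx : '[a ** f, x] = 0.
  have := qn_form_cyclic Q a f x; rewrite T_fx fa T_f T_fa => /eqP.
  by rewrite mulr0 !addr0 => /eqP.
have T_xfa : '[x ** f, a] = 0 by rewrite qn_form_swap.
(* This is the A1 coordinate of [a ** a]; its vanishing makes the product on A1 trivial. *)
have T_aaa : '[a ** a, a] = 0 by apply: qn_form_cube.
exists triple_data; split; last first.
  move=> [[s t] h] [[s' t'] h']; rewrite /= /transport_form triple_form /=.
  by rewrite /line_form (dual_lineE h s') (dual_lineE h' s); ring.
move=> u v; rewrite /= /transport_mul {1}/triple_to !triple_product_form.
rewrite !T_fx !T_ff !T_fa !T_f !T_fx !T_ff !T_fa T_xfx T_afa T_afx T_xfa T_aaa.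
rewrite f_x ff fa.
case: u v => [[s t] h] [[s' t'] h'] /=; congr (_, _, _).
- by rewrite line_mulE; ring.
- rewrite /rank1_bilin /rank1_lin /= !scale_lfunE !id_lfunE /GRing.scale /=.
  ring.
apply/lfunP => z; rewrite /rank1_bilin.
rewrite !(add_lfunE, opp_lfunE, scale_lfunE, id_lfunE) LstarE RdualE.
rewrite [h' (_ + _)]dual_lineE [h (nov_mul _ _ _)]dual_lineE /= !line_mulE.
rewrite /GRing.scale /=; ring.
Qed.

End AdaptedTriple.

(** * Existence of adapted triples over an algebraically closed field *)

Section AdaptedTripleExists.
Import VectorInternalTheory.
Variables (C : numClosedFieldType) (A : vectType C) (Q : quad_novikov A).
Hypothesis dimA : \dim {:A} = 3%N.
Implicit Types u v w : A.

Local Notation "u ** v" := (nov_mul Q u v) (at level 40).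
Local Notation "''[' u , v ]" := (qn_form Q u v).
Local Notation "u ^!" := (orthov (qn_form Q) <[u]>%VS).

Let nz2 : (2 : C) != 0. Proof. by rewrite pnatr_eq0. Qed.
Let nz3 : (3 : C) != 0. Proof. by rewrite pnatr_eq0. Qed.

Lemma anisotropic_normalize u : '[u, u] != 0 ->
  exists2 k, k != 0 & '[k *: u, k *: u] = 1.
Proof.
move=> uu; exists (sqrtC '[u, u])^-1; first by rewrite invr_eq0 sqrtC_eq0.
rewrite linearZl_LR linearZr_LR /= mulrA -invfM -expr2 sqrtCK.
by rewrite mulVf.
Qed.

Lemma hyperbolic_extend_pair x f : '[x, x] = 0 -> '[f, f] = 0 -> '[x, f] = 1 ->
  exists a, hyperbolic_triple Q x a f.
Proof.
move=> xx ff xf; have fx : '[f, x] = 1 by rewrite qn_formC.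
have dimW := hyperbolic_perp_dim dimA xx ff xf.
set W := (f^! :&: x^!)%VS in dimW.
pose a := vpick W.
have a_neq0 : a != 0 by rewrite vpick0 -dimv_eq0 dimW.
have /andP[/eqP af /eqP ax] : ('[a, f] == 0) && ('[a, x] == 0).
  by rewrite -mem_perp2 memv_pick.
have W_line : W = <[a]>%VS.
  by apply/eqP; rewrite eq_sym eqEdim -memvE memv_pick dim_vline a_neq0 dimW.
have aa : '[a, a] != 0.
  (* If [a] were isotropic it would be orthogonal to [x], [f] and itself, hence to everything,
     against nondegeneracy. *)
  apply: contra a_neq0 => /eqP aa; apply/eqP/(@qn_form_inj _ _ Q) => w.
  have /vlineP[k wk] : w - '[w, f] *: x - '[w, x] *: f \in <[a]>%VS.
    rewrite -W_line mem_perp2 !linearBl /= !linearZl_LR /= xx ff xf fx.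
    by rewrite !mulr0 !mulr1 !subr0 !subrr eqxx.
  have -> : w = k *: a + '[w, x] *: f + '[w, f] *: x by rewrite -wk !subrK.
  rewrite !linearDr /= !linearZr_LR /= aa af ax !linear0l.
  by rewrite !mulr0 !addr0.
have [k _ kk] := anisotropic_normalize aa.
by exists (k *: a); split; split=> //; rewrite linearZl_LR /= ?ax ?af mulr0.
Qed.

(** The perp of [e] has dimension at least 2, and a binary form over an algebraically closed field
    has an isotropic vector: two orthogonal anisotropic vectors combine through a square root. *)
Lemma isotropic_in_perp e : exists2 f, f != 0 & '[f, f] = 0 /\ '[f, e] = 0.
Proof.
have dim_e : (2 <= \dim e^!)%N.
  by have := leq_dim_orthov1 (qn_form Q) e fullv; rewrite dimA capfv.
pose u := vpick e^!.
have u_neq0 : u != 0 by rewrite vpick0 -dimv_eq0 -lt0n (leq_trans _ dim_e).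
have ue : '[u, e] = 0 by apply/eqP; rewrite -mem_orthov1 memv_pick.
have [uu|uu] := eqVneq '[u, u] 0; first by exists u.
pose w := vpick (e^! :&: u^!)%VS.
have w_neq0 : w != 0.
  rewrite vpick0 -dimv_eq0 -lt0n.
  apply: leq_trans (leq_dim_orthov1 (qn_form Q) u e^!).
  by case: (\dim _) dim_e => [|[]].
have /andP[/eqP we /eqP wu] : ('[w, e] == 0) && ('[w, u] == 0).
  by rewrite -mem_perp2 memv_pick.
have uw : '[u, w] = 0 by rewrite qn_formC.
clearbody u w.
have [ww|ww] := eqVneq '[w, w] 0; first by exists w.
exists (u + sqrtC (- '[u, u] / '[w, w]) *: w); last split.
- apply/eqP => f0; move: uu.
  have : '[u + sqrtC (- '[u, u] / '[w, w]) *: w, u] = 0 by rewrite f0 linear0l.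
  by rewrite linearDl linearZl_LR /= wu mulr0 addr0 => ->; rewrite eqxx.
- rewrite !linearDl /= !linearDr /= !linearZl_LR !linearZr_LR /= uw wu.
  rewrite !mulr0 !addr0 !add0r mulrA -expr2 sqrtCK.
  by field.
by rewrite linearDl linearZl_LR /= we ue mulr0 addr0.
Qed.

(** A common eigenvector is taken for the commuting matrices of right multiplication by basis
    vectors; linearity in the right factor then covers every [b]. *)
Lemma right_mul_eigenvector :
  exists2 e, e != 0 & forall b, exists k, e ** b = k *: e.
Proof.
pose R b := lin1_mx (v2r \o applyr (nov_mul Q) b \o r2v : _ -> 'rV_(dim A)).
have RE b w : v2r w *m R b = v2r (w ** b).
  by rewrite mul_rV_lin1 /= v2rK.
have R_comm : {in [seq R b | b <- vbasis fullv] &, forall M N, comm_mx M N}.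
  move=> _ _ /mapP[b _ ->] /mapP[b' _ ->]; apply/row_matrixP => i.
  rewrite !rowE !mulmxA -[delta_mx _ _]r2vK !RE.
  by rewrite nov_rcom.
have dim_gt0 : (0 < dim A)%N by rewrite -dimvf dimA.
have [v v_neq0 /allP v_stable] := common_eigenvector dim_gt0 R_comm.
exists (r2v v).
  by apply: contra v_neq0 => /eqP v0; rewrite -[v]r2vK v0 linear0.
move=> b; apply/vlineP; rewrite (coord_vbasis (memvf b)).
rewrite linear_sumr memv_suml // => i _; rewrite linearZr_LR /= memvZ //.
have /sub_rVP[k vk] : (v *m R (vbasis fullv)`_i <= v)%MS.
  by apply: v_stable; rewrite map_f ?mem_nth ?size_tuple.
apply/vlineP; exists k; apply: (can_inj v2rK).
by rewrite -RE r2vK vk linearZ /= r2vK.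
Qed.

Definition adapted_triple x a f c :=
  hyperbolic_triple Q x a f /\ [/\ f ** f = 0, f ** a = 0 & f ** x = c *: f].

Lemma adapted_triple_isotropic f : f != 0 -> '[f, f] = 0 ->
  (forall b, exists k, f ** b = k *: f) -> exists x a c, adapted_triple x a f c.
Proof.
move=> f_neq0 ff f_eigen.
have [x [xx xf]] := isotropic_partner nz2 f_neq0 ff.
have [a xaf] := hyperbolic_extend_pair xx ff xf.
have [_ [ax af aa]] := xaf.
have fx1 : '[f, x] = 1 by rewrite qn_formC.
have fa0 : '[f, a] = 0 by rewrite qn_formC.
have [c fx] := f_eigen x; have [l fa] := f_eigen a; have [k fk] := f_eigen f.
have T_fx w : '[f ** x, w] = c * '[f, w] by rewrite fx linearZl_LR.
have T_fa w : '[f ** a, w] = l * '[f, w] by rewrite fa linearZl_LR.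
have T_ff w : '[f ** f, w] = k * '[f, w] by rewrite fk linearZl_LR.
have T_f u v : '[u ** v, f] = '[f ** v, u] by rewrite qn_form_swap.
(* In the cyclic sum at (f,f,x) the term T(f,x,f) vanishes and the other two equal [k]. *)
have k0 : k = 0.
  have := qn_form_cyclic Q f f x; rewrite (T_f x f) T_fx T_ff fx1 ff => /eqP.
  have -> : k * 1 + c * 0 + k * 1 = 2 * k by ring.
  by rewrite mulf_eq0 (negPf nz2) => /eqP.
have a_f : a ** f = - l *: f.
  rewrite (hyperbolic_decomp dimA (a ** f) xaf) T_f T_ff fa0 mulr0 scale0r add0r.
  have -> : '[a ** f, a] = 0.
    have := qn_form_cyclic Q a f a; rewrite (T_f a a) !T_fa fa0 mulr0 => /eqP.
    by rewrite !addr0 => /eqP.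
  have := qn_form_cyclic Q a f x; rewrite (T_f x a) T_fx T_fa fa0 fx1 => /eqP.
  by rewrite mulr0 mulr1 addr0 addr_eq0 scale0r add0r => /eqP ->.
have a_a : a ** a = '[a ** a, x] *: f.
  rewrite {1}(hyperbolic_decomp dimA (a ** a) xaf) T_f T_fa fa0 mulr0 scale0r.
  by rewrite qn_form_cube // scale0r !add0r.
(* Right commutativity (a o a) o f = (a o f) o a reads 0 = -l^2 f. *)
have l0 : l = 0.
  have := nov_rcom Q a a f; rewrite a_a a_f !linearZl_LR /= fk fa k0.
  rewrite scale0r scaler0 scalerA => /esym/eqP.
  by rewrite scaler_eq0 (negPf f_neq0) orbF mulNr oppr_eq0 mulf_eq0 orbb => /eqP.
exists x, a, c; split=> //; split=> //; first by rewrite fk k0 scale0r.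
by rewrite fa l0 scale0r.
Qed.

Lemma adapted_triple_anisotropic e : '[e, e] != 0 ->
  (forall b, exists k, e ** b = k *: e) -> exists x a f c, adapted_triple x a f c.
Proof.
move=> ee e_eigen.
have e_e : '[e ** e, e] = 0 by apply: qn_form_cube.
(* T(e,e,e) = 0 kills the eigenvalue of [e] on itself; the cyclic sum at (e,b,e) then reduces to l
   B(e,e) = 0. *)
have e_null b : e ** b = 0.
  have [k ek] := e_eigen e; have [l eb] := e_eigen b.
  move/eqP: e_e; rewrite ek linearZl_LR /= mulf_eq0 (negPf ee) orbF => /eqP k0.
  have := qn_form_cyclic Q e b e.
  rewrite (qn_form_swap Q b e e) eb ek k0 scale0r linear0l !addr0 => /eqP.
  by rewrite linearZl_LR /= mulf_eq0 (negPf ee) orbF => /eqP ->; rewrite scale0r.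
have [r _ aa] := anisotropic_normalize ee.
have a_null b : (r *: e) ** b = 0 by rewrite linearZl_LR /= e_null scaler0.
move: (r *: e) aa a_null => a aa a_null {r e_null e_e ee e_eigen}.
have [f f_neq0 [ff fa]] := isotropic_in_perp a.
have af : '[a, f] = 0 by rewrite qn_formC.
have [x xaf] := hyperbolic_extend_anisotropic nz2 f_neq0 ff af aa.
have fax := hyperbolic_triple_sym xaf.
have null_a b : b ** a = 0.
  apply: (@qn_form_inj _ _ Q) => w; rewrite linear0l.
  have := qn_form_cyclic Q a w b; rewrite (qn_form_swap Q w b a) !a_null.
  by rewrite !linear0l !add0r.
have T_a u v : '[u ** v, a] = 0 by rewrite qn_form_swap a_null linear0l.
(* All products on the plane spanned by [x] and [f] are determined by these two numbers. *)
set p := '[x ** x, f]; set q := '[f ** f, x].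
have xfx : '[f ** x, x] = p by rewrite qn_form_swap.
have fxf : '[x ** f, f] = q by rewrite qn_form_swap.
have f_f : f ** f = q *: f.
  rewrite (hyperbolic_decomp dimA (f ** f) xaf) T_a qn_form_cube //.
  by rewrite !scale0r !add0r.
have x_x : x ** x = p *: x.
  rewrite (hyperbolic_decomp dimA (x ** x) fax) T_a qn_form_cube //.
  by rewrite !scale0r !add0r.
have T_fxf : '[f ** x, f] = - (2 * q).
  have := qn_form_cyclic Q f x f; rewrite fxf -/q => /eqP.
  by rewrite -addrA addr_eq0 => /eqP ->; ring.
have T_xfx : '[x ** f, x] = - (2 * p).
  have := qn_form_cyclic Q x f x; rewrite xfx -/p => /eqP.
  by rewrite -addrA addr_eq0 => /eqP ->; ring.
have f_x : f ** x = - (2 * q) *: x + p *: f.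
  by rewrite (hyperbolic_decomp dimA (f ** x) xaf) T_a T_fxf xfx scale0r addr0.
have x_f : x ** f = q *: x - (2 * p) *: f.
  rewrite (hyperbolic_decomp dimA (x ** f) xaf) T_a T_xfx fxf scale0r addr0.
  by rewrite scaleNr.
(* Pairing (f o x) o f = (f o f) o x with [x] gives 5pq = pq. *)
have pq0 : p * q = 0.
  have := congr1 (fun u => '[u, x]) (nov_rcom Q f x f).
  rewrite /= f_x f_f linearDl /= !linearZl_LR /= linearDl /= !linearZl_LR /=.
  rewrite T_xfx -/q xfx => /eqP; rewrite -subr_eq0.
  have -> : - (2 * q) * - (2 * p) + p * q - q * p = 2 * (2 * (p * q)) by ring.
  by rewrite !mulf_eq0 !(negPf nz2) /= -mulf_eq0 => /eqP.
have /orP[/eqP p0|/eqP q0] : (p == 0) || (q == 0) by rewrite -mulf_eq0 pq0.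
  (* When p = 0 the roles of [x] and [f] are exchanged. *)
  exists f, a, x, q; split=> //; split; rewrite ?null_a //.
    by rewrite x_x p0 scale0r.
  by rewrite x_f p0 mulr0 scale0r subr0.
exists x, a, f, p; split=> //; split; rewrite ?null_a //.
  by rewrite f_f q0 scale0r.
by rewrite f_x q0 mulr0 oppr0 scale0r add0r.
Qed.

Lemma adapted_triple_exists : exists x a f c, adapted_triple x a f c.
Proof.
have [e e_neq0 e_eigen] := right_mul_eigenvector.
have [ee|ee] := eqVneq '[e, e] 0; last exact: adapted_triple_anisotropic ee e_eigen.
have [x [a [c xaf]]] := adapted_triple_isotropic e_neq0 ee e_eigen.
by exists x, a, e, c.
Qed.

End AdaptedTripleExists.

Theorem mainTheorem9 (R : realType) (A : vectType R[i]) (Q : quad_novikov A)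
    (dimA : \dim {:A} = 3%N) (Q_nontrivial : ~ nov_trivial Q) :
  exists (A1 A2 : vectType R[i]) (Q1 : quad_novikov A1) (N2 : novikov A2)
         (tau : {symmetric A2}) (D : quad_novikov (dext_space A1 A2)),
    [/\ \dim {:A1} = 1%N /\ nov_trivial Q1,
        \dim {:A2} = 1%N,
        is_double_extension Q1 N2 tau D
      & qn_isomorphic Q D].
Proof.
have [x [a [f [c [xaf [ff fa fx]]]]]] := adapted_triple_exists Q dimA.
have nz3 : (3 : R[i]) != 0 by rewrite pnatr_eq0.
exists R[i]^o, R[i]^o, (trivial_line R[i]), (line_novikov c), (line_form 0).
exists (triple_dext dimA xaf); split.
- by split; [exact: dim_line|exact: trivial_line_trivial].
- exact: dim_line.
- exact: triple_double_extension.
exact: transport_isomorphic.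
Qed.
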